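(* Let $G$ and $H$ be Hamiltonian graphs. (1) If $G$ and $H$ are relatively prime, then $G\mathbin{\square}H$ is not Hamiltonian-transitive. (2) If $G$ is prime, then for every integer $n\ge 1$, the graph $G^{\square n}$ is Hamiltonian-transitive if and only if $n=1$ and $G$ is Hamiltonian-transitive.
   Context: All graphs are finite, simple and undirected. A Hamiltonian cycle is a cycle (of length at least 3) through all vertices, identified with its edge set; a graph is Hamiltonian if it has one (so it has at least 3 vertices). A graph is Hamiltonian-transitive if it is Hamiltonian and for every pair of Hamiltonian cycles there is an automorphism of the graph mapping one to the other. The Cartesian product $G\mathbin{\square}H$ has vertex set $V(G)\times V(H)$, with $(g,h)$ and $(g',h')$ adjacent iff ($g=g'$ and $\{h,h'\}\in E(H)$) or ($h=h'$ and $\{g,g'\}\in E(G)$). $G^{\square n}$ is the Cartesian product of $n$ copies of $G$. A graph with more than one vertex is prime if it is not isomorphic to a Cartesian product of two graphs each having more than one vertex. Every connected graph has a unique (up to order and isomorphism) decomposition as a Cartesian product of prime graphs, called its prime factors. Two graphs are relatively prime if they have no common (up to isomorphism) prime factor. *)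

(* Defs.v *)
From mathcomp Require Import all_boot.
From Stdlib Require List.

Set Implicit Arguments.
Unset Strict Implicit.
Unset Printing Implicit Defensive.

Record sgraph := SGraph {
  vertex :> finType;
  adj : rel vertex;
  adj_sym : symmetric adj;
  adj_irrefl : irreflexive adj
}.

Definition is_iso (G H : sgraph) (f : G -> H) : Prop :=
  bijective f /\ forall x y : G, adj (f x) (f y) = adj x y.

Definition isomorphic (G H : sgraph) : Prop := exists f : G -> H, is_iso f.

Definition is_automorphism (G : sgraph) (f : G -> G) : Prop := is_iso f.

(* Edges are two-element vertex sets. [next s] is the cyclic successor in [s]. *)
Definition cycle_edges (G : sgraph) (s : seq G) : {set {set G}} :=
  [set [set x; next s x] | x in s].

Definition hamiltonian_cycle (G : sgraph) (C : {set {set G}}) : Prop :=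
  exists s : seq G,
    [/\ 3 <= size s, ucycle (@adj G) s, forall x : G, x \in s
      & C = cycle_edges s].

Definition hamiltonian (G : sgraph) : Prop :=
  exists C : {set {set G}}, hamiltonian_cycle C.

Definition hamiltonian_transitive (G : sgraph) : Prop :=
  hamiltonian G /\
  forall C D : {set {set G}}, hamiltonian_cycle C -> hamiltonian_cycle D ->
    exists f : G -> G,
      is_automorphism f /\ [set f @: (e : {set G}) | e in C] = D.

Section CartesianProduct.
Variables G H : sgraph.

Definition box_adj : rel (G * H) := fun u v =>
  (u.1 == v.1) && adj u.2 v.2 || (u.2 == v.2) && adj u.1 v.1.

Lemma box_adj_sym : symmetric box_adj.
Proof.
move=> u v; rewrite /box_adj (eq_sym u.1) (eq_sym u.2).
by rewrite (adj_sym u.1) (adj_sym u.2).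
Qed.

Lemma box_adj_irrefl : irreflexive box_adj.
Proof. by move=> u; rewrite /box_adj !adj_irrefl !andbF. Qed.

Definition box : sgraph := SGraph box_adj_sym box_adj_irrefl.

End CartesianProduct.

Definition K1 : sgraph :=
  @SGraph unit (fun _ _ => false) (fun _ _ => erefl) (fun _ => erefl).

(* [box_pow G 1] is [G] itself, [box_pow G n.+2] is [box G (box_pow G n.+1)],
   and the empty product [box_pow G 0] is [K1]. *)
Definition box_pow (G : sgraph) (n : nat) : sgraph := iterop n box G K1.

Definition prime_graph (G : sgraph) : Prop :=
  1 < #|G| /\
  ~ exists A B : sgraph, [/\ 1 < #|A|, 1 < #|B| & isomorphic G (box A B)].

Definition prime_decomposition (G : sgraph) (s : seq sgraph) : Prop :=
  List.Forall prime_graph s /\ isomorphic G (foldr box K1 s).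

(* For connected [G] (in particular for Hamiltonian [G]) the decomposition is
   unique up to order and isomorphism, so that the choice of [s] is immaterial. *)
Definition prime_factor (P G : sgraph) : Prop :=
  exists s : seq sgraph, prime_decomposition G s /\ List.Exists (isomorphic P) s.

Definition relatively_prime (G H : sgraph) : Prop :=
  ~ exists P : sgraph, prime_factor P G /\ prime_factor P H.

(* Main.v *)
Require Import Defs.
From mathcomp Require Import all_boot zify.

Set Implicit Arguments.
Unset Strict Implicit.
Unset Printing Implicit Defensive.

(* The product of two Hamiltonian graphs always has two Hamiltonian cycles that
   no automorphism maps to each other.  Colour the edges of the product by the
   transitive closure of "opposite in a 4-cycle".  Automorphisms permute the colours, an edge of [G] and an edge of [H] never
   share a colour, and the copies of one edge of [G] (or [H]) all have the same
   colour.  Hence the sum over all colours of the squared number of edges of that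
   colour is an invariant of a Hamiltonian cycle under automorphisms.

   Let [xs], [ys] be Hamiltonian cycles of [G], [H] of lengths m, n.  A closed
   walk h_0 .. h_(n-1) along [xs] gives a Hamiltonian cycle of the product: in
   layer j go once round [xs] from h_j to its neighbour h_(j+1), then step to
   layer j+1.  If two consecutive layers are run in the same direction, a switch
   in a square x0 x1 * y0 y1 moves two edges from colour a = x0x1 to colour
   b = y0y1, which preserves the invariant only if N_a = N_b + 2.
   - m <= n both odd: walk once round and then zigzag.  All N_a with a in [G] are
     even, whereas N_b is odd for some b, since these N_b add up to n.
   - n even, [xs] not of one colour: moving one turning point of a zigzag changes
     two omitted edges, and preserving the invariant would force n to divide 2.
   - n even, [xs] of one colour: N_a = n(m-1) is too large for N_a = N_b + 2. *)

(* [lia] slows down badly on boolean atoms and boolean hypotheses. *)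
Ltac count_lia :=
  repeat match goal with
  | |- context [nat_of_bool ?b] => generalize (nat_of_bool b)
  | |- context [@count ?T ?a ?s] => generalize (@count T a s)
  end; clear; lia.

(** * Edge labels along closed walks *)

Section CyclicPairmap.
Variables (T : eqType) (C : eqType) (k : T -> T -> C).

(** [k] stands for an edge colouring, but also, with [C := bool], for an adjacency relation. One
    exchange lemma on such lists then yields both the colour counts and the cyclicity of a
    rearranged walk. *)
Definition cpairmap (s : seq T) : seq C :=
  if s is x :: p then pairmap k x (rcons p x) else [::].

Lemma pairmap_rcons x p y :
  pairmap k x (rcons p y) = rcons (pairmap k x p) (k (last x p) y).
Proof. by rewrite -!cats1 pairmap_cat. Qed.

Lemma cpairmap_cat x p y q :
  cpairmap ((x :: p) ++ y :: q) =
    pairmap k x p ++ k (last x p) y :: rcons (pairmap k y q) (k (last y q) x).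
Proof. by rewrite /= rcons_cat pairmap_cat /= pairmap_rcons. Qed.

Lemma perm_cpairmap_rot i s : perm_eq (cpairmap (rot i s)) (cpairmap s).
Proof.
rewrite -{2}(cat_take_drop i s) /rot.
case: (take i s) (drop i s) => [|x p] [|y q]; rewrite ?cats0 ?cat0s //.
apply/permP => a.
rewrite !cpairmap_cat -!cats1.
by rewrite ?count_cat /= ?count_cat /=; count_lia.
Qed.

Lemma cpairmap_next s : uniq s -> cpairmap s = [seq k x (next s x) | x <- s].
Proof.
case: s => [|x p] // Us.
have sz : size (pairmap k x (rcons p x)) = (size p).+1.
  by rewrite size_pairmap size_rcons.
apply: (@eq_from_nth _ (k x x)); first by rewrite sz size_map.
move=> i; rewrite /cpairmap sz => lti.
rewrite (nth_pairmap x) ?size_rcons // (nth_map x) //.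
rewrite next_nth mem_nth // index_uniq //.
rewrite -rcons_cons nth_rcons /= lti nth_rcons.
by case: (ltnP i (size p)) => // lei; rewrite if_same [nth x p i]nth_default.
Qed.

Hypothesis k_sym : forall x y, k x y = k y x.

Lemma last_rev_belast x p : last (last x p) (rev (belast x p)) = x :> T.
Proof. by case: p => //= y p; rewrite rev_cons last_rcons. Qed.

Lemma pairmap_rev x p :
  pairmap k (last x p) (rev (belast x p)) = rev (pairmap k x p).
Proof.
elim: p x => [|y p IH] x //=.
by rewrite !rev_cons pairmap_rcons IH last_rev_belast k_sym.
Qed.

(* Reversing the arc [v .. w] of a cycle [v .. w z .. u] exchanges the two
   edges [wz], [uv] for [vz], [uw]. *)
Lemma perm_cpairmap_flip v p z q :
  perm_eq (k (last v p) z :: k (last z q) v :: cpairmap (rev (v :: p) ++ z :: q))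
    (k v z :: k (last z q) (last v p) :: cpairmap ((v :: p) ++ z :: q)).
Proof.
have -> : rev (v :: p) = last v p :: rev (belast v p) by rewrite lastI rev_rcons.
rewrite !cpairmap_cat pairmap_rev last_rev_belast.
apply/permP => a; rewrite /= !count_cat /= -!cats1 !count_cat count_rev /=; count_lia.
Qed.

End CyclicPairmap.

Lemma path_all_pairmap (T : eqType) (e : rel T) x p :
  path e x p = all id (pairmap e x p).
Proof. by elim: p x => //= y p IH x; rewrite IH. Qed.

Lemma cycle_all_cpairmap (T : eqType) (e : rel T) s :
  cycle e s = all id (cpairmap e s).
Proof. by case: s => //= x p; rewrite path_all_pairmap. Qed.

Lemma eq_in_pairmap (T C : eqType) (e : rel T) (k k' : T -> T -> C) x p :
  (forall x y, e x y -> k x y = k' x y) -> path e x p ->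
  pairmap k x p = pairmap k' x p.
Proof.
by move=> kk'; elim: p x => //= y p IH x /andP[/kk' -> /IH ->].
Qed.

Lemma pairmap_map (S T : Type) (C : Type) (k : T -> T -> C) (f : S -> T) x p :
  pairmap k (f x) (map f p) = pairmap (fun a b => k (f a) (f b)) x p.
Proof. by elim: p x => //= y p IH x; rewrite IH. Qed.

(** * Walks along a cycle, and rows that omit one of its edges *)

Definition cyc_adj (T : eqType) (xs : seq T) : rel T :=
  fun u v => (v == next xs u) || (v == prev xs u).

Lemma cyc_adj_sym (T : eqType) (xs : seq T) : uniq xs -> symmetric (cyc_adj xs).
Proof.
move=> Ux u v; rewrite /cyc_adj.
by apply/orP/orP => -[] /eqP ->; rewrite ?next_prev ?prev_next ?eqxx; auto.
Qed.

Lemma prev_head (T : eqType) (x : T) p : uniq (x :: p) -> prev (x :: p) x = last x p.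
Proof.
rewrite cons_uniq => /andP[xp _]; rewrite prev_nth mem_head memNindex //.
by rewrite -[size p]/(size (x :: p)).-1 nth_last.
Qed.

Section Rows.
Variables (T : eqType) (e : rel T) (C : eqType) (c : T -> T -> C).
Hypothesis e_sym : symmetric e.
Hypothesis c_sym : forall x y, c x y = c y x.
Variable xs : seq T.
Hypothesis xs_cycle : ucycle e xs.

(** Rotated to start at [u], the cycle ends at [prev xs u], and dropping its closing edge leaves the
    path. If [v] is [next xs u], the path starting at [v] ends at [u] and is reversed. Putting the
    omitted edge back into the labels avoids subtraction. *)
Lemma spanning_row u v : u \in xs -> cyc_adj xs u v ->
  exists p, [/\ perm_eq (u :: p) xs, path e u p, last u p = v
    & perm_eq (c u v :: pairmap c u p) (cpairmap c xs)].
Proof.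
have /andP[Cx Ux] := xs_cycle.
have back w : w \in xs -> exists p, [/\ perm_eq (w :: p) xs, path e w p,
    last w p = prev xs w
    & perm_eq (c w (prev xs w) :: pairmap c w p) (cpairmap c xs)].
  case/rot_to => i p def_p; exists p.
  have lw : last w p = prev xs w.
    by rewrite -(prev_rot i) // def_p prev_head // -def_p rot_uniq.
  split=> //; first by rewrite -def_p perm_rot.
    have: cycle e (rot i xs) by rewrite rot_cycle.
    by rewrite def_p /= rcons_path => /andP[].
  rewrite -(permPr (perm_cpairmap_rot c i xs)) def_p /= pairmap_rcons lw.
  by rewrite -(perm_rcons (c w (prev xs w))) c_sym.
move=> xs_u /orP[] /eqP ->; last exact: back.
have [|p [pp ep lp cp]] := back (next xs u); first by rewrite mem_next.
move: lp cp; rewrite prev_next // => lp cp.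
exists (rev (belast (next xs u) p)).
split.
- have -> : u :: rev (belast (next xs u) p) = rev (next xs u :: p).
    by rewrite [in RHS]lastI lp rev_rcons.
  by rewrite perm_rev.
- by rewrite -{1}lp rev_path; rewrite (eq_path (e' := e)) // => a b; rewrite e_sym.
- by rewrite -{1}lp last_rev_belast.
have := pairmap_rev c_sym (next xs u) p; rewrite lp => ->.
by rewrite -(permPr cp) c_sym perm_cons perm_rev.
Qed.

End Rows.

(** * Hamiltonian cycles of a product, built row by row *)

Section BoxCycles.
Variables (G H : sgraph) (C : eqType).
Variables (k : G * H -> G * H -> C) (cG : G -> G -> C) (cH : H -> H -> C).
Hypothesis k_sym : forall u v, k u v = k v u.
Hypothesis cG_sym : forall x x', cG x x' = cG x' x.
Hypothesis kG : forall y x x', adj x x' -> k (x, y) (x', y) = cG x x'.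
Hypothesis kH : forall x y y', adj y y' -> k (x, y) (x, y') = cH y y'.

Local Notation layer y s := [seq (x, y) | x <- s].

Lemma path_layer (y : H) (x : G) p :
  path (@adj G) x p -> path (@box_adj G H) (x, y) (layer y p).
Proof.
by elim: p x => //= x' p IH x /andP[xx' /IH ->]; rewrite /box_adj /= xx' eqxx orbT.
Qed.

Lemma pairmap_layer (y : H) (x : G) p :
  path (@adj G) x p -> pairmap k (x, y) (layer y p) = pairmap cG x p.
Proof.
rewrite (pairmap_map k (fun x => (x, y))).
by apply: eq_in_pairmap => a b; apply: kG.
Qed.

Lemma last_layer (y : H) (x : G) p : last (x, y) (layer y p) = (last x p, y).
Proof. exact: (last_map (fun x => (x, y))). Qed.

Variable xs : seq G.
Hypothesis xs_cycle : ucycle (@adj G) xs.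
Hypothesis xs_all : forall x, x \in xs.

(* The row from [u] to the next vertex [v] of the walk uses all edges of [xs]
   except [uv]. *)
Lemma helix y yt u hs : size hs = (size yt).+1 ->
    path (cyc_adj xs) u hs -> path (@adj H) y yt ->
  exists L, [/\ path (@box_adj G H) (u, y) L,
    last (u, y) L = (last u hs, last y yt),
    perm_eq ((u, y) :: L) [seq (x, b) | b <- y :: yt, x <- xs]
    & forall c, count_mem c (pairmap k (u, y) L) + count_mem c (pairmap cG u hs) =
      (size yt).+1 * count_mem c (cpairmap cG xs) + count_mem c (pairmap cH y yt)].
Proof.
elim: yt y u hs => [|y' yt IH] y u [|v hs] //= [szh] /andP[uv vhs].
  case: hs szh vhs => // _ _ _.
  have [p [pp ep lp cp]] := spanning_row (@adj_sym G) cG_sym xs_cycle (xs_all u) uv.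
  exists (layer y p); rewrite path_layer // last_layer lp pairmap_layer //.
  split=> //; first by rewrite cats0 -[_ :: _]/(layer y (u :: p)) perm_map.
  by move=> c; have /permP/(_ (pred1 c)) /= := cp; count_lia.
move=> /andP[yy' y'yt].
have [p [pp ep lp cp]] := spanning_row (@adj_sym G) cG_sym xs_cycle (xs_all u) uv.
have [L [pL lL peL cL]] := IH y' v hs szh vhs y'yt.
exists (layer y p ++ (v, y') :: L); split.
- by rewrite cat_path path_layer // last_layer lp /= pL /box_adj /= yy' eqxx.
- by rewrite last_cat last_cons lL.
- rewrite -cat_cons -[_ :: layer y p]/(layer y (u :: p)).
  by apply: perm_cat; [apply: perm_map | apply: peL].
move=> c; have /permP/(_ (pred1 c)) /= := cp; have := cL c.
rewrite pairmap_cat count_cat pairmap_layer // last_layer lp /= kH //; count_lia.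
Qed.

Lemma all_prod_seq (ys : seq H) s : (forall y, y \in ys) ->
  perm_eq s [seq (x, b) | b <- ys, x <- xs] -> forall u, u \in s.
Proof.
move=> ys_all /perm_mem s_xy [x y]; rewrite s_xy.
by apply/allpairsP; exists (y, x); rewrite ys_all xs_all.
Qed.

Lemma uniq_prod_seq (ys : seq H) s : uniq ys ->
  perm_eq s [seq (x, b) | b <- ys, x <- xs] -> uniq s.
Proof.
have /andP[_ Ux] := xs_cycle.
move=> Uy /perm_uniq ->; apply: allpairs_uniq => //.
by move=> [a b] [a' b'] _ _ /= [-> ->].
Qed.

Section Helix.
Variables (ys : seq H).
Hypothesis ys_cycle : ucycle (@adj H) ys.
Hypothesis ys_all : forall y, y \in ys.

(** Since the walk [h] is closed, the last row ends in the column where the first one starts, so the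
    edge from the last layer to the first closes the helix. *)
Lemma helix_cycle h : size h = size ys -> cycle (cyc_adj xs) h ->
  exists s, [/\ ucycle (@box_adj G H) s, forall u, u \in s
    & forall c, count_mem c (cpairmap k s) + count_mem c (cpairmap cG h) =
      size ys * count_mem c (cpairmap cG xs) + count_mem c (cpairmap cH ys)].
Proof.
case: ys ys_cycle ys_all => [|y yt] Cy ally; first by case: h => // _ _; exists [::];
  split=> // -[x y]; have := ally y.
case: h => // u hs [szh] Ch; have /andP[/= ] := Cy.
rewrite rcons_path => /andP[py ey] Uy.
have [|L [pL lL peL cL]] := @helix y yt u (rcons hs u) _ Ch py.
  by rewrite size_rcons szh.
rewrite last_rcons in lL.
exists ((u, y) :: L); split.
- rewrite /ucycle (uniq_prod_seq _ peL) //= andbT rcons_path pL lL /=.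
  by rewrite /box_adj /= eqxx ey.
- exact: all_prod_seq peL.
move=> c; have /= := cL c; rewrite !pairmap_rcons lL kH // -!cats1 !count_cat /=; count_lia.
Qed.

End Helix.

(* [s] is the cycle of the walk [x0, z, last x1 t & hs], whose first two layers
   have the same direction; [s'] is [s] after the switch in x0 x1 * y0 y1. *)
Lemma flip_cycle x0 x1 t z y0 y1 y2 yt hs :
    xs = x0 :: x1 :: rcons t z -> 
    ucycle (@adj H) [:: y0, y1, y2 & yt] ->
    (forall y, y \in [:: y0, y1, y2 & yt]) ->
    size hs = size yt -> path (cyc_adj xs) (last x1 t) (rcons hs x0) ->
  exists s s',
  [/\ ucycle (@box_adj G H) s /\ ucycle (@box_adj G H) s',
      forall u, (u \in s) && (u \in s'),
      forall c, count_mem c (cpairmap k s) +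
          count_mem c (cpairmap cG [:: x0, z, last x1 t & hs]) =
        (size yt).+3 * count_mem c (cpairmap cG xs) +
          count_mem c (cpairmap cH [:: y0, y1, y2 & yt])
    & forall c, count_mem c (cpairmap k s') + 2 * (cG x0 x1 == c) =
        count_mem c (cpairmap k s) + 2 * (cH y0 y1 == c)].
Proof.
set w := last x1 t => def_xs Cy ally szh w_hs.
have /and5P[y01 y12 py ey Uy] : [&& adj y0 y1, adj y1 y2, path (@adj H) y2 yt,
    adj (last y2 yt) y0 & uniq [:: y0, y1, y2 & yt]].
  by move: Cy; rewrite /ucycle /= rcons_path -!andbA.
have /and4P[x01 pt xwz zx0] :
    [&& adj x0 x1, path (@adj G) x1 t, adj w z & adj z x0].
  by move: xs_cycle; rewrite def_xs /ucycle /= !rcons_path last_rcons 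
    => /andP[/and3P[-> /andP[-> ->] ->] _].
have [|L [pL lL peL cL]] := @helix y2 yt w (rcons hs x0) _ w_hs py.
  by rewrite size_rcons szh.
rewrite last_rcons in lL.
(* The cycle is cut at its two edges over [x0 x1], in the layers [y0] and [y1]. One arc runs from
   [(x1, y0)] to [(x0, y1)], the other from [(x1, y1)] to [(x0, y0)]; reversing the first replaces
   the cut edges by two over [y0 y1]. *)
pose p := layer y0 (rcons t z) ++ [:: (z, y1); (x0, y1)].
pose q := layer y1 t ++ (w, y2) :: rcons L (x0, y0).
have lp : last (x1, y0) p = (x0, y1) by rewrite last_cat.
have lq : last (x1, y1) q = (x0, y0) by rewrite last_cat /= last_rcons.
have ptz : path (@adj G) x1 (rcons t z) by rewrite rcons_path pt.
have pp : path (@box_adj G H) (x1, y0) p.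
  rewrite cat_path path_layer // last_layer last_rcons /= /box_adj /= !eqxx.
  by rewrite y01 zx0 orbT.
have pq : path (@box_adj G H) (x1, y1) q.
  rewrite cat_path path_layer // last_layer /= rcons_path pL lL /box_adj /= !eqxx.
  by rewrite y12 ey.
have cp c : count_mem c (pairmap k (x1, y0) p) =
    count_mem c (pairmap cG x1 t) + (cG w z == c) + (cH y0 y1 == c) + (cG z x0 == c).
  rewrite pairmap_cat pairmap_layer // pairmap_rcons -cats1 last_layer last_rcons /=.
  by rewrite kG // kH // !count_cat /= -/w; count_lia.
have cq c : count_mem c (pairmap k (x1, y1) q) =
    count_mem c (pairmap cG x1 t) + (cH y1 y2 == c) +
    count_mem c (pairmap k (w, y2) L) + (cH (last y2 yt) y0 == c).
  rewrite pairmap_cat pairmap_layer // last_layer /= pairmap_rcons lL !kH //.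
  by rewrite -cats1 !count_cat /= !count_cat /=; count_lia.
pose s := ((x1, y0) :: p) ++ (x1, y1) :: q.
pose s' := rev ((x1, y0) :: p) ++ (x1, y1) :: q.
have s'_s : perm_eq s' s by rewrite perm_cat2r perm_rev.
have s_prod : perm_eq s [seq (x, b) | b <- [:: y0, y1, y2 & yt], x <- xs].
  apply/permP => a; move/permP/(_ a): peL.
  have -> : [seq (x, b) | b <- [:: y0, y1, y2 & yt], x <- xs] =
    layer y0 xs ++ layer y1 xs ++ [seq (x, b) | b <- y2 :: yt, x <- xs] by [].
  move: [seq (x, b) | b <- y2 :: yt, x <- xs] => M /= eM.
  rewrite !count_cat -eM def_xs /s /p /q /= !map_rcons -!cats1.
  by do 3! rewrite ?count_cat /=; count_lia.
have Us : uniq s by apply: uniq_prod_seq s_prod.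
have Cs : cycle (@box_adj G H) s.
  rewrite /s /= rcons_cat cat_path pp lp /= rcons_path pq lq /box_adj /= !eqxx x01.
  by rewrite !orbT.
exists s, s'; split.
- rewrite /ucycle Us Cs (perm_uniq s'_s) Us !andbT; split=> //.
  (* The exchange is read with adjacency as the label: all four edges of the square are present, so
     [s'] is a cycle because [s] is one. *)
  have := perm_cpairmap_flip (@box_adj_sym G H) (x1, y0) p (x1, y1) q.
  rewrite lp lq -/s -/s' => /(perm_all id).
  move: Cs; rewrite !cycle_all_cpairmap.
  move: (cpairmap _ s) (cpairmap _ s') => As As' /= ->.
  by rewrite /box_adj /= !eqxx y01 x01 !orbT /= => ->.
- by move=> u; rewrite (perm_mem s'_s) andbb; apply: all_prod_seq ally s_prod _.
- move=> c; rewrite /s cpairmap_cat lp lq !kG // count_cat /= -cats1 count_cat.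
  rewrite cp cq def_xs /= !pairmap_rcons !last_rcons -!cats1 !count_cat /=.
  have := cL c; rewrite def_xs /= !pairmap_rcons !last_rcons -!cats1 !count_cat /=.
  by rewrite (cG_sym x0 z) (cG_sym z w) -/w; count_lia.
move=> c; have := perm_cpairmap_flip k_sym (x1, y0) p (x1, y1) q.
rewrite lp lq -/s -/s' => /permP/(_ (pred1 c)) /=.
by rewrite !kG // !kH //; count_lia.
Qed.
End BoxCycles.

(** * Edge colours and the energy of an edge set *)

Lemma iso_inverse (K L : sgraph) (f : K -> L) : is_iso f ->
  exists g : L -> K, [/\ is_iso g, cancel f g & cancel g f].
Proof.
case=> -[g fg gf] f_adj; exists g; split=> //; split; first by exists f.
by move=> x y; rewrite -{2}(gf x) -{2}(gf y) f_adj.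
Qed.

Section Energy.
Variable K : sgraph.

Definition opposite : rel {set K} := fun e f =>
  [exists a, exists b, exists c, exists d,
    [&& e == [set a; b], f == [set c; d], adj a b, adj b c, adj c d, adj d a,
        a != c & b != d]].

Lemma oppositeP e f :
  reflect (exists a b c d : K, [/\ e = [set a; b], f = [set c; d],
      [/\ adj a b, adj b c, adj c d & adj d a] & a != c /\ b != d])
    (opposite e f).
Proof.
apply: (iffP existsP) => [[a /existsP[b /existsP[c /existsP[d]]]]|[a [b [c [d]]]]].
  case/and5P=> /eqP -> /eqP -> ab bc /and4P[cd da ac bd].
  by exists a, b, c, d.
case=> -> -> [ab bc cd da] [ac bd]; exists a; apply/existsP; exists b.
by apply/existsP; exists c; apply/existsP; exists d; rewrite !eqxx ab bc cd da ac.
Qed.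

Lemma opposite_sym : symmetric opposite.
Proof.
suff impl e f : opposite e f -> opposite f e by move=> e f; apply/idP/idP; exact: impl.
case/oppositeP=> a [b [c [d [-> -> [ab bc cd da] [ac bd]]]]].
by apply/oppositeP; exists c, d, a, b; split=> //; split; rewrite eq_sym.
Qed.

(** A colour is encoded as a chosen representative of its class. Automorphisms need not respect this
    choice; they only respect equality of colours. *)
Definition colour (e : {set K}) : {set K} := root opposite e.

Lemma colour_eq e f : (colour e == colour f) = connect opposite e f.
Proof. by apply: root_connect; apply: sym_connect_sym opposite_sym. Qed.

Lemma opposite_colour e f : opposite e f -> colour e = colour f.
Proof. by move/connect1; rewrite -colour_eq => /eqP. Qed.

Definition energy (C : {set {set K}}) : nat :=
  \sum_c #|[set e in C | colour e == c]| ^ 2.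

(** A sum of squared class sizes counts ordered pairs within a class. This form mentions no
    representatives, so automorphisms visibly preserve it. *)
Lemma energy_pairs C :
  energy C = \sum_(e in C) \sum_(f in C) connect opposite e f.
Proof.
rewrite /energy.
under eq_bigr => c _ do rewrite -sum1_card -mulnn big_distrl /=.
transitivity (\sum_(c : {set K}) \sum_(e in C | colour e == c)
   \sum_(f in C) connect opposite e f).
  apply: eq_bigr => c _; apply: eq_big => [e|e]; rewrite inE // => /andP[_ /eqP ec].
  rewrite mul1n big_mkcond /= [RHS]big_mkcond; apply: eq_bigr => f _.
  by rewrite inE -colour_eq ec eq_sym; case: (f \in C) => //; case: eqP.
by rewrite [RHS](partition_big colour predT).
Qed.

Lemma connect_opposite_imset (f : K -> K) e e' :
  is_automorphism f -> connect opposite e e' -> connect opposite (f @: e) (f @: e').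
Proof.
case=> /bij_inj f_inj f_adj /connectP[p + ->].
elim: p e => [|e1 p IH] e /= => [_|/andP[ee1 /IH]]; first exact: connect0.
apply: connect_trans; apply: connect1; apply/oppositeP.
case/oppositeP: ee1 => a [b [c [d [-> -> [ab bc cd da] [ac bd]]]]].
by exists (f a), (f b), (f c), (f d); rewrite !f_adj !(inj_eq f_inj) !imsetU1 !imset_set1.
Qed.

Lemma energy_automorphism (f : K -> K) (C : {set {set K}}) : is_automorphism f ->
  energy [set f @: (e : {set K}) | e in C] = energy C.
Proof.
move=> f_aut; have [g [g_aut fg _]] := iso_inverse f_aut.
have f_inj : injective (fun e : {set K} => f @: e).
  exact/imset_inj/(can_inj fg).
rewrite !energy_pairs big_imset /=; last by move=> ? ? _ _; apply: f_inj.
apply: eq_bigr => e _; rewrite big_imset /=; last by move=> ? ? _ _; apply: f_inj.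
apply: eq_bigr => e' _; congr nat_of_bool; apply/idP/idP; last first.
  exact: connect_opposite_imset.
have gfE (A : {set K}) : g @: (f @: A) = A.
  by rewrite -imset_comp (eq_imset _ (g := id)) ?imset_id.
by move/(connect_opposite_imset g_aut); rewrite !gfE.
Qed.

Lemma next_next (T : eqType) (s : seq T) x :
  uniq s -> 2 < size s -> x \in s -> next s (next s x) != x.
Proof.
move=> Us szs /rot_to[i p def_p].
have nE y : next s y = next (x :: p) y by rewrite -def_p next_rot.
rewrite !nE {nE}.
have: 2 < size (x :: p) by rewrite -def_p size_rot.
have: uniq (x :: p) by rewrite -def_p rot_uniq.
case: p {def_p} => [|y [|z r]] //= /and3P[+ _ _] _.
rewrite !inE eqxx !negb_or => /and3P[xy xz _].
by rewrite (eq_sym y x) (negPf xy) eqxx eq_sym.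
Qed.

(** Passing from the list to the edge set loses no multiplicity: if distinct [x] and [x'] gave the
    same edge, each would be the successor of the other, which a cycle of length at least 3
    excludes. *)
Lemma card_colour_cycle (s : seq K) c : uniq s -> 2 < size s ->
  #|[set e in cycle_edges s | colour e == c]| =
    count_mem c (cpairmap (fun u v : K => colour [set u; v]) s).
Proof.
move=> Us szs; rewrite cpairmap_next // count_map.
pose E x := [set x; next s x].
have -> : [set e in cycle_edges s | colour e == c] =
    E @: [set x in s | colour (E x) == c].
  apply/setP => e; rewrite inE; apply/andP/imsetP.
    by case=> /imsetP[x xs ->] ec; exists x; rewrite ?inE ?xs.
  by case=> x; rewrite inE => /andP[xs ec] ->; split=> //; apply/imsetP; exists x.
rewrite card_in_imset => [|x x'].
  rewrite -size_filter -(card_uniqP _) ?filter_uniq //; apply: eq_card => x.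
  by rewrite !inE mem_filter /= andbC.
rewrite !inE => /andP[xs _] /andP[x's _] Exx'.
have: x \in E x' by rewrite -Exx' !inE eqxx.
have: x' \in E x by rewrite Exx' !inE eqxx.
rewrite !inE => /orP[/eqP // | /eqP x'E] /orP[/eqP //|/eqP xE].
by case/eqP: (next_next Us szs x's); rewrite -xE -x'E.
Qed.

Lemma energy_cycle (s : seq K) : uniq s -> 2 < size s ->
  energy (cycle_edges s) =
    \sum_c count_mem c (cpairmap (fun u v : K => colour [set u; v]) s) ^ 2.
Proof. by move=> Us szs; apply: eq_bigr => c _; rewrite card_colour_cycle. Qed.

End Energy.

(** * Colours in a Cartesian product *)

Section BoxColour.
Variables G H : sgraph.
Local Notation K := (box G H).

Definition edge_colour (u v : K) : {set K} := colour [set u; v].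

Definition horizontal (e : {set K}) : bool :=
  [exists u in e, exists v in e, u.1 != v.1].

Lemma horizontal_set2 (u v : K) : horizontal [set u; v] = (u.1 != v.1).
Proof.
apply/existsP/idP => [[a /andP[+ /existsP[b /andP[]]]]|uv].
  by rewrite !inE => /orP[] /eqP -> /orP[] /eqP ->; rewrite ?eqxx // eq_sym.
exists u; rewrite !inE eqxx; apply/existsP; exists v.
by rewrite !inE eqxx orbT.
Qed.

Lemma box_adjP (u v : K) : adj u v ->
  u.1 = v.1 /\ u.2 <> v.2 \/ u.2 = v.2 /\ u.1 <> v.1.
Proof.
case/orP=> /andP[/eqP uv uv']; [left|right]; split=> // eq_uv.
  by rewrite eq_uv adj_irrefl in uv'.
by rewrite eq_uv adj_irrefl in uv'.
Qed.

(** If opposite edges changed different coordinates, the remaining two edges would have to restore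
    one coordinate each, and then two diagonal vertices of the 4-cycle would coincide. *)
Lemma horizontal_opposite (e f : {set K}) : opposite e f -> horizontal e = horizontal f.
Proof.
case/oppositeP=> -[a1 a2] [[b1 b2] [[c1 c2] [[d1 d2]]]] [-> ->].
rewrite !horizontal_set2 => -[] /box_adjP /= ab /box_adjP /= bc /box_adjP /= cd.
move=> /box_adjP /= da [/eqP ac /eqP bd]; congr (~~ _); apply/eqP/eqP => ?; subst.
- by case: ab bc cd da => [[? ?]|[? ?]] [[? ?]|[? ?]] [[? ?]|[? ?]] [[? ?]|[? ?]];
    congruence.
- by case: ab bc cd da => [[? ?]|[? ?]] [[? ?]|[? ?]] [[? ?]|[? ?]] [[? ?]|[? ?]];
    congruence.
Qed.

Lemma horizontal_colour (e f : {set K}) :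
  colour e = colour f -> horizontal e = horizontal f.
Proof.
move/eqP; rewrite colour_eq => /connectP[p + ->].
by elim: p e => //= e1 p IH e /andP[/horizontal_opposite -> /IH].
Qed.

(** Copies of [x x'] in two adjacent layers are opposite sides of a square; induction along a path
    does the rest. *)
Lemma colour_layer (x x' : G) (y y' : H) : adj x x' -> connect (@adj H) y y' ->
  edge_colour (x, y) (x', y) = edge_colour (x, y') (x', y').
Proof.
move=> xx' /connectP[p + ->]; elim: p y => //= y1 p IH y /andP[yy1 /IH <-].
apply: (@opposite_colour K); apply/oppositeP.
exists (x, y), (x', y), (x', y1), (x, y1).
have neq_xx' : x != x' by apply: contraTneq xx' => ->; rewrite adj_irrefl.
split=> //; first exact: setUC.
  by rewrite /= /box_adj /= !eqxx (adj_sym x') (adj_sym y1) xx' yy1 !orbT.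
by rewrite !xpair_eqE (eq_sym x') (negPf neq_xx').
Qed.

Lemma colour_fibre (x x' : G) (y y' : H) : adj y y' -> connect (@adj G) x x' ->
  edge_colour (x, y) (x, y') = edge_colour (x', y) (x', y').
Proof.
move=> yy' /connectP[p + ->]; elim: p x => //= x1 p IH x /andP[xx1 /IH <-].
apply: (@opposite_colour K); apply/oppositeP.
exists (x, y), (x, y'), (x1, y'), (x1, y).
have neq_yy' : y != y' by apply: contraTneq yy' => ->; rewrite adj_irrefl.
split=> //; first exact: setUC.
  by rewrite /= /box_adj /= !eqxx (adj_sym y') (adj_sym x1) xx1 yy' !orbT.
by rewrite !xpair_eqE (eq_sym y') (negPf neq_yy') !andbF.
Qed.

End BoxColour.

(** * Arithmetic of the energy, and zigzag walks *)

Lemma sum_sqr_transfer (C : finType) (f g : C -> nat) a b : a != b ->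
    (forall c, g c + 2 * (a == c) = f c + 2 * (b == c)) ->
  \sum_c g c ^ 2 = \sum_c f c ^ 2 -> f a = f b + 2.
Proof.
move=> ab fg; rewrite (bigD1 a) // [in RHS](bigD1 a) //=.
rewrite (bigD1 b) 1?eq_sym // [in RHS](bigD1 b) 1?eq_sym //=.
have -> : \sum_(c | (c != a) && (c != b)) g c ^ 2 = \sum_(c | (c != a) && (c != b)) f c ^ 2.
  apply: eq_bigr => c /andP[ca cb]; have := fg c.
  by rewrite eq_sym (negPf ca) eq_sym (negPf cb) !muln0 !addn0 => ->.
(* Moving two units from [a] to [b] changes the sum of squares by [4 (f b + 2 - f a)]. *)
have := fg a; have := fg b; rewrite !eqxx (negPf ab) eq_sym (negPf ab).
move: (f a) (f b) (g a) (g b) (\sum_(_ | _) _) => fa fb ga gb S; clear.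
rewrite !muln0 !muln1 !addn0 -!mulnn => -> <-; nia.
Qed.

Lemma sum_count_mem (C : finType) (s : seq C) : \sum_c count_mem c s = size s.
Proof.
elim: s => [|c s IH] /=; first by rewrite big1.
rewrite big_split /= IH (bigD1 c) //= eqxx big1 ?addn0 ?add1n // => b.
by rewrite eq_sym => /negPf ->.
Qed.

Lemma rot_head (T : eqType) (s : seq T) x : 1 < size s -> x \in s -> uniq s ->
  exists i t, rot i s = [:: x, next s x & t].
Proof.
move=> szs /rot_to[i [|y p] def_p] Us.
  by move: szs; rewrite -(size_rot i) def_p.
exists i, p; rewrite def_p; congr [:: _, _ & _].
by rewrite -(next_rot i) // def_p /= eqxx.
Qed.

Section Zigzag.
Variables (T : eqType) (x z : T).

Definition zigzag k := flatten (nseq k [:: x; z]).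

Lemma size_zigzag k : size (zigzag k) = 2 * k.
Proof. by elim: k => //= k IH; rewrite -/(zigzag k) IH; lia. Qed.

Lemma path_zigzag (e : rel T) u k :
  e u x -> e x z -> e z x -> path e u (rcons (zigzag k) x).
Proof.
move=> + xz zx; elim: k u => [|k IH] u ux /=; first by rewrite ux.
by rewrite ux xz; apply: IH.
Qed.

Lemma count_zigzag (C : eqType) (f : T -> T -> C) c u k : f z x = f x z ->
  count_mem c (pairmap f u (rcons (zigzag k) x)) = (f u x == c) + 2 * k * (f x z == c).
Proof.
move=> fzx; elim: k u => [|k IH] u /=; first by rewrite muln0.
by rewrite -/(zigzag k) IH fzx; count_lia.
Qed.

End Zigzag.

Lemma cycle_cyc_adj (T : eqType) (s : seq T) : uniq s -> cycle (cyc_adj s) s.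
Proof.
move=> Us; apply: sub_cycle (cycle_next Us) => x y /eqP <-.
by rewrite /cyc_adj eqxx.
Qed.

(** For [f] the successor along a cycle, a labelling unchanged by one step is constant on the
    cycle. *)
Lemma path_invariant (T : eqType) (C : eqType) (g : T -> C) f x p :
  (forall y, g (f y) = g y) -> fpath f x p -> all (fun y => g y == g x) p.
Proof.
move=> gf; elim: p x => //= y p IH x /andP[/eqP <- /IH].
by rewrite gf eqxx.
Qed.

Lemma three_cons (T : Type) (s : seq T) : 2 < size s ->
  exists x0 x1 t z, s = [:: x0, x1 & rcons t z].
Proof.
case: s => [|x0 [|x1 s]] //=; case/lastP: s => // t z _.
by exists x0, x1, t, z.
Qed.

(** * Two spanning cycles of different energy *)

Section TwoCycles.
Variables (G H : sgraph) (C : finType).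
Variables (k : G * H -> G * H -> C) (cG : G -> G -> C) (cH : H -> H -> C).
Hypothesis k_sym : forall u v, k u v = k v u.
Hypothesis cG_sym : forall x x', cG x x' = cG x' x.
Hypothesis kG : forall y x x', adj x x' -> k (x, y) (x', y) = cG x x'.
Hypothesis kH : forall x y y', adj y y' -> k (x, y) (x, y') = cH y y'.
Hypothesis cGH : forall x x' y y', adj x x' -> adj y y' -> cG x x' != cH y y'.

Lemma count_cG_cH x x' ys : adj x x' -> ucycle (@adj H) ys ->
  count_mem (cG x x') (cpairmap cH ys) = 0.
Proof.
move=> xx' /andP[Cy Uy]; apply/count_memPn; rewrite cpairmap_next //.
by apply/mapP => -[y yys /eqP]; apply/negP/cGH => //; apply: next_cycle.
Qed.

Lemma count_cH_cG y y' xs : adj y y' -> ucycle (@adj G) xs ->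
  count_mem (cH y y') (cpairmap cG xs) = 0.
Proof.
move=> yy' /andP[Cx Ux]; apply/count_memPn; rewrite cpairmap_next //.
apply/mapP => -[x xxs /eqP]; rewrite eq_sym; apply/negP/cGH => //.
exact: next_cycle.
Qed.

Definition spanning_cycle (s : seq (G * H)) : Prop :=
  ucycle (@box_adj G H) s /\ forall u, u \in s.

Definition colour_energy (s : seq (G * H)) : nat :=
  \sum_c count_mem c (cpairmap k s) ^ 2.

Lemma two_cycles_odd xs ys :
    ucycle (@adj G) xs -> (forall x, x \in xs) -> 2 < size xs ->
    ucycle (@adj H) ys -> (forall y, y \in ys) -> odd (size xs) -> odd (size ys) ->
    size xs <= size ys ->
  exists s s', [/\ spanning_cycle s, spanning_cycle s' &
    colour_energy s != colour_energy s'].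
Proof.
move=> Cx allx szx Cy ally oddx oddy le_xy.
have szy := leq_trans szx le_xy.
have /andP[_ Uy] := Cy; have /andP[_ Ux] := Cx.
(* The colour counts along [ys] add up to the odd number [size ys], so one of them is odd; the
   switch uses an edge of that colour. *)
have [y0 oddy0] : exists y0, odd (count_mem (cH y0 (next ys y0)) (cpairmap cH ys)).
  have /existsP[c oddc] : [exists c, odd (count_mem c (cpairmap cH ys))].
    apply: contraTT oddy => /existsPn even_c.
    have <- : size (cpairmap cH ys) = size ys by rewrite cpairmap_next // size_map.
    rewrite -sum_count_mem; apply: (big_ind (fun m => ~~ odd m)) => // a b.
    by rewrite oddD => /negPf -> /negPf ->.
  have: c \in cpairmap cH ys by rewrite -has_pred1 has_count; case: count oddc.
  by rewrite {1}cpairmap_next // => /mapP[y0 _ def_c]; exists y0; rewrite -def_c.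
have [i [[|y2 yt] def_ys]] := rot_head (ltnW szy) (ally y0) Uy.
  by move: szy; rewrite -(size_rot i) def_ys.
move: (next ys y0) oddy0 def_ys => y1 oddy0 def_ys.
have Cy' : ucycle (@adj H) [:: y0, y1, y2 & yt] by rewrite -def_ys rot_ucycle.
have ally' y : y \in [:: y0, y1, y2 & yt] by rewrite -def_ys mem_rot.
have y01 : adj y0 y1 by case/andP: Cy' => /andP[].
have [x0 [x1 [t [z def_xs]]]] := three_cons szx.
have x01 : adj x0 x1 by case/andP: Cx; rewrite def_xs => /andP[].
pose n := (size ys - size xs)./2.
have def_n : size ys = size xs + 2 * n.
  by rewrite /n mul2n halfK oddB // oddx oddy subn0 subnKC.
pose hs := rev (belast x1 t) ++ zigzag x0 z n.
have Ct := cycle_cyc_adj Ux.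
have /and5P[a01 at1 awz az0 _] : [&& cyc_adj xs x0 x1, path (cyc_adj xs) x1 t,
    cyc_adj xs (last x1 t) z, cyc_adj xs z x0 & true].
  by move: Ct; rewrite {2}def_xs /= !rcons_path last_rcons => /and3P[-> /andP[-> ->] ->].
have hs_path : path (cyc_adj xs) (last x1 t) (rcons hs x0).
  rewrite rcons_cat cat_path last_rev_belast rev_path.
  rewrite (eq_path (e' := cyc_adj xs)) ?at1 /=; last first.
    by move=> u v; rewrite cyc_adj_sym.
  by apply: path_zigzag => //; rewrite cyc_adj_sym.
have size_hs : size hs = size yt.
  rewrite size_cat size_rev size_belast size_zigzag.
  have := def_n; rewrite -(size_rot i) def_ys def_xs /= size_rcons; clear; lia.
have [s [s' [[Cs Cs'] all_ss' cs cs']]] :=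
  flip_cycle k_sym cG_sym kG kH Cx allx def_xs Cy' ally' size_hs hs_path.
exists s, s'; split.
- by split=> // u; case/andP: (all_ss' u).
- by split=> // u; case/andP: (all_ss' u).
apply/eqP => /esym /(sum_sqr_transfer (cGH x01 y01) cs') Eab.
have := cs (cH y0 y1); have := cs (cG x0 x1); rewrite Eab.
(* The round omits every edge of [xs] once, and the zigzags omit [x0 z] another [2 * n] times. *)
have omitted c : count_mem c (cpairmap cG [:: x0, z, last x1 t & hs]) =
    count_mem c (cpairmap cG xs) + 2 * n * (cG x0 z == c).
  rewrite def_xs /= rcons_cat pairmap_cat last_rev_belast pairmap_rev //.
  rewrite count_cat count_rev count_zigzag // !pairmap_rcons last_rcons.
  rewrite -!cats1 !count_cat /= (cG_sym z x0) (cG_sym z (last _ _)) (cG_sym x0 x1).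
  by count_lia.
rewrite !omitted count_cG_cH // (count_cH_cG y01 Cx).
have /permP/(_ (pred1 (cH y0 y1))) := perm_cpairmap_rot cH i ys.
rewrite def_ys => ->.
have -> : cG x0 z == cH y0 y1 = false.
  apply: negPf; apply: cGH y01; rewrite adj_sym; case/andP: Cx; rewrite def_xs => /= + _.
  by rewrite !rcons_path last_rcons => /and3P[].
have szyt : odd (size yt).+3 by move: oddy; rewrite -(size_rot i) def_ys.
(* Parity: as [m] is odd, the colour of [x0 x1] occurs an even number of times, whereas that of
   [y0 y1] occurs an odd number of times, against [Eab]. *)
rewrite muln0 addn0.
move: (count_mem _ (cpairmap cG xs)) (nat_of_bool _) oddy0 szyt => A B.
move: (count_mem _ (cpairmap cH ys)) (count_mem _ (cpairmap k s)) => b N.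
move: (size yt).+3 => m oddb oddm E1 E2.
move: E2; rewrite !muln0 !addn0 add0n => E2.
have := congr1 odd E1; rewrite E2.
by rewrite !oddD !oddM oddb oddm /=; case: (odd A).
Qed.

Lemma two_cycles_even xs ys :
    ucycle (@adj G) xs -> (forall x, x \in xs) -> 2 < size xs ->
    ucycle (@adj H) ys -> (forall y, y \in ys) -> 2 < size ys -> ~~ odd (size ys) ->
  exists s s', [/\ spanning_cycle s, spanning_cycle s' &
    colour_energy s != colour_energy s'].
Proof.
move=> Cx allx szx Cy ally szy eveny.
have [n size_ys] : exists n, size ys = 2 * n + 4.
  exists ((size ys)./2 - 2); have := odd_double_half (size ys).
  by rewrite (negPf eveny); lia.
have [y0 [y1 [y2 [yt def_ys]]]] : exists y0 y1 y2 yt, ys = [:: y0, y1, y2 & yt].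
  by case: ys szy {Cy ally eveny size_ys} => [|y0 [|y1 [|y2 yt]]] // _; exists y0, y1, y2, yt.
have y01 : adj y0 y1 by case/andP: Cy; rewrite def_ys => /andP[].
(* With [w := last x1 t], the walk is [x0, z, w, z] followed by [n] zigzags on [x0 z]. It omits
   [z x0] in [2 * n + 2] rows and [w z] in two. *)
have flip x0 x1 t z xs' : ucycle (@adj G) xs' -> (forall x, x \in xs') ->
    xs' = [:: x0, x1 & rcons t z] -> 
  [/\ adj x0 x1, adj (last x1 t) z, adj z x0 & exists s s',
    [/\ spanning_cycle s, spanning_cycle s',
    forall c, count_mem c (cpairmap k s) + (2 * n + 2) * (cG z x0 == c) +
        2 * (cG (last x1 t) z == c) =
      size ys * count_mem c (cpairmap cG xs') + count_mem c (cpairmap cH ys)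
    & forall c, count_mem c (cpairmap k s') + 2 * (cG x0 x1 == c) =
        count_mem c (cpairmap k s) + 2 * (cH y0 y1 == c)]].
  move=> Cx' allx' def_xs; have /andP[Cx'' Ux'] := Cx'.
  have /and3P[x01 xwz xz0] : [&& adj x0 x1, adj (last x1 t) z & adj z x0].
    by move: Cx''; rewrite def_xs /= !rcons_path last_rcons => /and3P[-> /andP[_ ->] ->].
  have /andP[awz az0] : cyc_adj xs' (last x1 t) z && cyc_adj xs' z x0.
    have := cycle_cyc_adj Ux'.
    by rewrite {2}def_xs /= !rcons_path last_rcons => /and3P[_ /andP[_ ->] ->].
  split=> //; pose hs := z :: zigzag x0 z n.
  have hs_path : path (cyc_adj xs') (last x1 t) (rcons hs x0).
    by rewrite /= awz path_zigzag // cyc_adj_sym.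
  have size_hs : size hs = size yt.
    by rewrite /= size_zigzag; move: size_ys; rewrite def_ys /=; clear; lia.
  move: (Cy) ally; rewrite def_ys => Cy' ally'.
  have [s [s' [[Cs Cs'] all_ss' cs cs']]] :=
    flip_cycle k_sym cG_sym kG kH Cx' allx' def_xs Cy' ally' size_hs hs_path.
  exists s, s'; split=> //.
  - by split=> // u; case/andP: (all_ss' u).
  - by split=> // u; case/andP: (all_ss' u).
  move=> c; rewrite -cs /= count_zigzag // (cG_sym x0 z) (cG_sym z (last _ _)).
  by count_lia.
have /andP[Cx' Ux] := Cx; pose f x := cG x (next xs x).
have szx1 : 1 < size xs by rewrite ltnW.
(* Either [xs] has a single colour, or two consecutive edges differ in colour. *)
case: (boolP [forall x, f (next xs x) == f x]) => [/forallP f_const | /forallPn[w fw]].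
  have [x0 [x1 [t [z def_xs]]]] := three_cons szx.
  have [x01 xwz xz0 [s [s' [Ss Ss' cs cs']]]] := flip _ _ _ _ _ Cx allx def_xs.
  exists s, s'; split=> //.
  apply/eqP => /esym /(sum_sqr_transfer (cGH x01 y01) cs') Eab.
  have ff x : f x = f x0.
    have := cycle_next Ux; rewrite {2}def_xs.
    rewrite -[cycle _ _]/(fpath _ x0 (rcons (x1 :: rcons t z) x0)).
    move/(path_invariant (fun y => eqP (f_const y)))/allP/(_ x) => fx.
    by apply/eqP/fx; rewrite -cats1 mem_cat mem_seq1 orbC -in_cons -def_xs.
  have f01 : cG x0 x1 = f x0 by rewrite /f def_xs /= eqxx.
  have colG x : cG x (next xs x) = cG x0 x1 by rewrite f01 -(ff x).
  have calc : count_mem (cG x0 x1) (cpairmap cG xs) = size xs.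
    rewrite cpairmap_next // count_map -[RHS]count_predT; apply: eq_count => x /=.
    by rewrite colG // eqxx.
  (* At most [2 * n + 4], that is [size ys], edges are omitted, so the colour of [xs] occurs at
     least [size ys * (size xs - 1)] times. This exceeds [size ys + 2], the most that [Eab]
     allows. *)
  have := cs (cH y0 y1); have := cs (cG x0 x1).
  rewrite Eab calc (count_cH_cG y01 Cx) count_cG_cH //.
  have := count_size (pred1 (cH y0 y1)) (cpairmap cH ys).
  rewrite [size (cpairmap _ _)](_ : _ = size ys); last first.
    by rewrite cpairmap_next ?size_map //; case/andP: Cy.
  move: (count_mem _ (cpairmap cH ys)) (count_mem _ (cpairmap k s)) => b N.
  have := leq_b1 (cG z x0 == cG x0 x1); have := leq_b1 (cG (last x1 t) z == cG x0 x1).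
  move: (nat_of_bool (_ == cG x0 x1)) (nat_of_bool (_ == cG x0 x1)) => b1 b2.
  move: (nat_of_bool _) (nat_of_bool _) => b3 b4.
  move: (size xs) (size ys) szx size_ys => m m'; clear => mgt m'E ? ? ? E1 E2.
  nia.
(* The consecutive edges [w z] and [z x0] have different colours. *)
pose z := next xs w; pose x0 := next xs z.
have [i [[|x0' r] def_r]] := rot_head szx1 (allx w) Ux.
  by move: szx; rewrite -(size_rot i) def_r.
have nextE y : next xs y = next [:: w, z, x0' & r] y by rewrite -def_r next_rot.
have Ur : uniq [:: w, z, x0' & r] by rewrite -def_r rot_uniq.
have def_x0 : x0' = x0.
  move: Ur; rewrite /x0 nextE /= !inE => /andP[/norP[/negPf wz _] _].
  by rewrite eq_sym wz eqxx.
rewrite {}def_x0 in def_r.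
(* Now the cycle starts at [x0] and ends with [w, z], as [flip] requires; for length 3, [x1] is [w]
   itself. *)
pose xs' := rot 2 (rot i xs).
have Cx2 : ucycle (@adj G) xs' by rewrite !rot_ucycle.
have allx2 x : x \in xs' by rewrite !mem_rot.
have [x1 [t [def_xs' def_w]]] : exists x1 t, xs' = [:: x0, x1 & rcons t z] /\ last x1 t = w.
  rewrite /xs' def_r; case: (r) => [|x1 t]; first by exists w, [::].
  by exists x1, (rcons t w); rewrite last_rcons /rot /= ?drop0 -!cats1 -catA.
have [x01 xwz xz0 [s1 [_ [Ss1 _ cs1 _]]]] := flip _ _ _ _ _ Cx2 allx2 def_xs'.
rewrite def_w in xwz cs1.
have /andP[_ Ux2] := Cx2.
have az0 : cyc_adj xs' z x0.
  have := cycle_cyc_adj Ux2.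
  by rewrite {2}def_xs' /= !rcons_path last_rcons => /and3P[_ _ ->].
have size_zz : size (zigzag x0 z n.+2) = size ys by rewrite size_zigzag size_ys; lia.
have cycle_zz : cycle (cyc_adj xs') (zigzag x0 z n.+2).
  rewrite -[cycle _ _]/(_ && path _ z (rcons (zigzag x0 z n.+1) x0)).
  by rewrite path_zigzag // cyc_adj_sym // az0.
(* The pure zigzag [s0] omits [z x0] in every row, while [s1] omits [w z] in two rows instead. *)
have [s0 [Cs0 alls0 cs0]] := helix_cycle cG_sym kG kH Cx2 allx2 Cy ally size_zz cycle_zz.
exists s0, s1; split=> //; apply/eqP => /esym.
have neq_ab : cG w z != cG z x0 by rewrite eq_sym; apply: fw.
have czz c : count_mem c (cpairmap cG (zigzag x0 z n.+2)) = (2 * n + 4) * (cG z x0 == c).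
  rewrite -[cpairmap _ _]/(cG x0 z :: pairmap cG z (rcons (zigzag x0 z n.+1) x0)).
  by rewrite /= count_zigzag // (cG_sym x0 z); count_lia.
have cs01 c : count_mem c (cpairmap k s1) + 2 * (cG w z == c) =
    count_mem c (cpairmap k s0) + 2 * (cG z x0 == c).
  by have := etrans (cs0 c) (esym (cs1 c)); rewrite czz; count_lia.
move/(sum_sqr_transfer neq_ab cs01) => Eab.
have := cs0 (cG w z); have := cs0 (cG z x0); rewrite Eab !czz !count_cG_cH //.
rewrite eqxx eq_sym (negPf neq_ab) !addn0 muln0 muln1 addn0 -size_ys.
move: (count_mem _ (cpairmap k s0)) (count_mem _ (cpairmap cG _)) => N A.
move: (count_mem _ (cpairmap cG _)) => B.
move: (size ys) szy => m mgt; clear -mgt => E1 E2.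
(* Modulo [m] this says that 2 vanishes, which [m > 2] forbids. *)
have E : A * m + 2 = B.+1 * m by rewrite mulSn ![_ * m]mulnC -E1 -E2; lia.
by have := congr1 (modn^~ m) E; rewrite modnMDl modn_small // modnMl.
Qed.

End TwoCycles.

(** * Transport along isomorphisms, and the conclusion for products and powers *)

Lemma image_hamiltonian_cycle (K L : sgraph) (f : K -> L) C : is_iso f ->
  hamiltonian_cycle C -> hamiltonian_cycle [set f @: (e : {set K}) | e in C].
Proof.
case=> f_bij f_adj [s [szs Cs alls ->]]; have f_inj := bij_inj f_bij.
have [g fg gf] := f_bij; have /andP[Cy Us] := Cs.
exists (map f s); split.
- by rewrite size_map.
- rewrite /ucycle (map_inj_uniq f_inj) Us andbT cycle_map.
  by rewrite (eq_cycle (e' := @adj K)) //; apply: f_adj.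
- by move=> y; rewrite -(gf y) map_f.
have next_f x : next (map f s) (f x) = f (next s x) by apply: next_map.
apply/setP => e; apply/imsetP/imsetP => [[_ /imsetP[x xs ->] ->]|[_ /mapP[x xs ->] ->]].
  by exists (f x); rewrite ?map_f // next_f imsetU1 imset_set1.
exists [set x; next s x]; first by apply/imsetP; exists x.
by rewrite next_f imsetU1 imset_set1.
Qed.

Lemma iso_comp (K L M : sgraph) (f : K -> L) (g : L -> M) :
  is_iso f -> is_iso g -> is_iso (g \o f).
Proof.
by move=> [f_bij fE] [g_bij gE]; split=> [|x y /=]; [apply: bij_comp | rewrite gE fE].
Qed.

(** A positive form of non-transitivity: it passes along isomorphisms and also certifies that the
    graph is Hamiltonian, which the induction on powers needs. *)
Definition inequivalent_cycles (K : sgraph) : Prop :=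
  exists C D : {set {set K}}, [/\ hamiltonian_cycle C, hamiltonian_cycle D &
    forall f : K -> K, is_automorphism f -> [set f @: (e : {set K}) | e in C] <> D].

Lemma inequivalent_cycles_iso (K L : sgraph) (f : K -> L) :
  is_iso f -> inequivalent_cycles K -> inequivalent_cycles L.
Proof.
move=> f_iso [C [D [hC hD CD]]]; have [g [g_iso fg gf]] := iso_inverse f_iso.
exists [set f @: (e : {set K}) | e in C], [set f @: (e : {set K}) | e in D].
split; [exact: image_hamiltonian_cycle.. |].
(* Conjugation turns an automorphism of [L] into one of [K]. *)
move=> h h_aut hCD; apply: (CD (g \o (h \o f))).
  by apply: iso_comp g_iso; apply: iso_comp h_aut.
have <- : [set g @: (e : {set L}) | e in [set f @: (e : {set K}) | e in D]] = D.
  rewrite -imset_comp -[RHS]imset_id; apply: eq_imset => e /=.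
  by rewrite -imset_comp -[RHS]imset_id; apply: eq_imset => x /=.
rewrite -hCD -!imset_comp; apply: eq_imset => e /=.
by rewrite -!imset_comp.
Qed.

Lemma hamiltonian_spanning (K : sgraph) : hamiltonian K ->
  exists s : seq K, [/\ 2 < size s, ucycle (@adj K) s & forall x, x \in s].
Proof. by case=> _ [s [? ? ? _]]; exists s. Qed.

Lemma ucycle_connect (K : sgraph) (s : seq K) :
  ucycle (@adj K) s -> (forall x, x \in s) -> forall x y, connect (@adj K) x y.
Proof.
case/andP=> Cs Us alls x y.
have [i p def_p] := rot_to (alls x).
have: cycle (@adj K) (x :: p) by rewrite -def_p rot_cycle.
rewrite /= rcons_path => /andP[xp _].
have: y \in x :: p by rewrite -def_p mem_rot.
move=> yp; case/splitPl: yp xp => p1 p2 <-; rewrite cat_path => /andP[xp1 _].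
by apply/connectP; exists p1.
Qed.

Lemma box_inequivalent_parity (G H : sgraph) (xs : seq G) (ys : seq H) :
    ucycle (@adj G) xs -> (forall x, x \in xs) -> 2 < size xs ->
    ucycle (@adj H) ys -> (forall y, y \in ys) -> 2 < size ys ->
    ~~ odd (size ys) || odd (size xs) && (size xs <= size ys) ->
  inequivalent_cycles (box G H).
Proof.
move=> Cx allx szx Cy ally szy parity.
have [x0 _] : exists x0, x0 \in xs by case: xs szx {Cx allx parity} => // x0 p;
  exists x0; exact: mem_head.
have [y0 _] : exists y0, y0 \in ys by case: ys szy {Cy ally parity} => // y0 p;
  exists y0; exact: mem_head.
pose k := @edge_colour G H.
(* Colours of edges are read off in one layer and one fibre; connectedness of the factors makes this
   choice harmless. *)
pose cG x x' := k (x, y0) (x', y0); pose cH y y' := k (x0, y) (x0, y').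
have k_sym u v : k u v = k v u by rewrite /k /edge_colour setUC.
have cG_sym x x' : cG x x' = cG x' x by apply: k_sym.
have kG y x x' : adj x x' -> k (x, y) (x', y) = cG x x'.
  by move=> xx'; apply: colour_layer xx' _; apply: ucycle_connect Cy ally _ _.
have kH x y y' : adj y y' -> k (x, y) (x, y') = cH y y'.
  by move=> yy'; apply: colour_fibre yy' _; apply: ucycle_connect Cx allx _ _.
have cGH x x' y y' : adj x x' -> adj y y' -> cG x x' != cH y y'.
  move=> xx' _; apply/eqP => /horizontal_colour; rewrite !horizontal_set2 /= eqxx.
  by move/negbFE/eqP=> eq_xx'; rewrite eq_xx' adj_irrefl in xx'.
have [s [s' [[Cs alls] [Cs' alls'] ss']]] : exists s s',
    [/\ spanning_cycle s, spanning_cycle s' & colour_energy k s != colour_energy k s'].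
  case/orP: parity => [even_y | /andP[odd_x le_xy]].
    exact: (two_cycles_even k_sym cG_sym kG kH cGH Cx allx szx Cy ally szy even_y).
  case: (boolP (odd (size ys))) => [odd_y | even_y].
    exact: (two_cycles_odd k_sym cG_sym kG kH cGH Cx allx szx Cy ally odd_x odd_y le_xy).
  exact: (two_cycles_even k_sym cG_sym kG kH cGH Cx allx szx Cy ally szy even_y).
have size_gt2 (r : seq (box G H)) : (forall u, u \in r) -> 2 < size r.
  move=> allr; apply: leq_trans szx _; rewrite -(size_map (fun x => (x, y0))).
  apply: uniq_leq_size => [|u _]; last exact: allr.
  by rewrite map_inj_uniq => [|x x' []]; [case/andP: Cx|].
exists (cycle_edges (G := box G H) s), (cycle_edges (G := box G H) s'); split.
- by exists s; split=> //; apply: size_gt2.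
- by exists s'; split=> //; apply: size_gt2.
move=> f f_aut fss'; case/eqP: ss'.
have /andP[_ Us] := Cs; have /andP[_ Us'] := Cs'.
have := energy_automorphism (cycle_edges (G := box G H) s) f_aut.
by rewrite fss' !energy_cycle // ?size_gt2.
Qed.

Lemma swap_iso (G H : sgraph) : is_iso (fun u : box G H => (u.2, u.1) : box H G).
Proof.
split; first by exists (fun u : box H G => (u.2, u.1) : box G H); case.
by move=> u v; rewrite /= /box_adj /= orbC.
Qed.

(** Up to exchanging the factors, the parity condition always holds: an even cycle is put second,
    and of two odd cycles the longer one. *)
Lemma box_inequivalent (G H : sgraph) :
  hamiltonian G -> hamiltonian H -> inequivalent_cycles (box G H).
Proof.
move=> /hamiltonian_spanning[xs [szx Cx allx]] /hamiltonian_spanning[ys [szy Cy ally]].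
case: (boolP (~~ odd (size ys) || odd (size xs) && (size xs <= size ys))) => [|not_xy].
  exact: box_inequivalent_parity.
apply: inequivalent_cycles_iso (swap_iso H G) _.
apply: (box_inequivalent_parity Cy ally szy Cx allx szx).
move: not_xy; rewrite negb_or negbK negb_and -ltnNge => /andP[-> /orP[->//|/ltnW ->]].
exact: orbT.
Qed.

Lemma inequivalent_not_transitive (K : sgraph) :
  inequivalent_cycles K -> ~ hamiltonian_transitive K.
Proof.
by move=> [C [D [hC hD CD]]] [_ /(_ C D hC hD)[f [f_aut]]]; apply: CD.
Qed.

Lemma hamiltonian_box_pow (G : sgraph) n : hamiltonian G -> hamiltonian (box_pow G n.+1).
Proof.
move=> hG; elim: n => [|n IH] //.
by have [C [_ [hC _ _]]] := box_inequivalent hG IH; exists C.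
Qed.

Theorem theorem4 (G H : sgraph) (hG : hamiltonian G) (hH : hamiltonian H) :
  (relatively_prime G H -> ~ hamiltonian_transitive (box G H)) /\
  (prime_graph G ->
     forall n : nat, 1 <= n ->
       (hamiltonian_transitive (box_pow G n) <->
        n = 1 /\ hamiltonian_transitive G)).
Proof.
(* The first power is [G] itself, and every higher power is a product of two Hamiltonian graphs. *)
split=> [_ | _ [|[|n]] // _].
- exact/inequivalent_not_transitive/box_inequivalent.
- by split=> [|[]].
split=> [|[]] // trans; case: (inequivalent_not_transitive _ trans).
exact/(box_inequivalent hG)/hamiltonian_box_pow.
Qed.
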